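(* Let $\mu:\mathbf{P}^+\to[0,\infty)$ have bounded maximal size and let $\delta>0$. Let $\mu'$ be a non-negative measure on the upper half-plane $\mathbb{R}^2_+$ obeying the weak Carleson condition $$\mu'(P)\le C_1|I_P|\quad\text{for all }P\in\mathbf{P}^+,$$ and such that $\|\mu'\|_{\mathrm{size}(T)}\le C_2$ for all convex trees $T$ with $\|\mu\|_{\mathrm{size}^*(T)}\le\delta$. Then $\mu'$ also has bounded maximal size: $$\|\mu'\|_{\mathrm{size}^*(\mathbf{P}^+)}\le C\big(\|\mu\|_{\mathrm{size}^*(\mathbf{P}^+)},\delta\big)\,(C_1+C_2),$$ where $C(\|\mu\|_{\mathrm{size}^*(\mathbf{P}^+)},\delta)$ is a constant depending only on $\|\mu\|_{\mathrm{size}^*(\mathbf{P}^+)}$ and $\delta$ (in particular not on $M$).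
   Context: Fix an integer $M>0$. A dyadic interval is an interval $[j2^k,(j+1)2^k]$ with $j,k$ integers, $-M\le k\le M$, contained in $[0,2^M]$; there are finitely many. Each dyadic interval $I$ has an associated lacunary tile $P^+(I)=I\times[1/|I|,2/|I|]$; $\mathbf{P}^+$ is the set of all lacunary tiles, and for $P=P^+(I)$ write $I_P=I$. Partial order: $P\le' Q$ iff $I_P\subseteq I_Q$. A tree is a collection $T\subseteq\mathbf{P}^+$ with a top tile $P_T\in T$ such that $P\le'P_T$ for all $P\in T$; $I_T:=I_{P_T}$. A collection $\mathbf{P}\subseteq\mathbf{P}^+$ is convex if $P_1\le'P\le'P_2$ with $P_1,P_2\in\mathbf{P}$, $P\in\mathbf{P}^+$ implies $P\in\mathbf{P}$. For $a\ge0$ defined on tiles, $\|a\|_{\mathrm{size}(T)}=\frac1{|I_T|}\sum_{P\in T}a(P)$, and the maximal size is $\|a\|_{\mathrm{size}^*(\mathbf{P})}=\sup_T\|a\|_{\mathrm{size}(T)}$, the supremum over all convex trees $T\subseteq\mathbf{P}$ ($0$ if $\mathbf{P}$ is empty). A non-negative measure $\mu'$ on $\mathbb{R}^2_+=\{(x,t):x\in\mathbb{R},t>0\}$ is regarded as a function on tiles by $\mu'(P^+(I)):=\mu'(Q^+(I))$, where $Q^+(I)=I\times[|I|/2,|I|]$ is the Whitney box over $I$ (sets of measure zero, such as boundaries of boxes, are ignored, so the Whitney boxes are treated as disjoint). *)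

(* Defs.v *)
From HB Require Import structures.
From mathcomp Require Import all_boot all_order all_algebra.
From mathcomp Require Import all_classical all_reals all_analysis.
From mathcomp Require Import ring lra zify.

Set Implicit Arguments.
Unset Strict Implicit.
Unset Printing Implicit Defensive.

Import Order.TTheory GRing.Theory Num.Theory.
Local Open Scope classical_set_scope.
Local Open Scope ring_scope.

(* [Tagged _ j : dyadic M], with tag i : 'I_(2M+1), encodes the interval
   [j2^k, (j+1)2^k] with k = i - M.  The bound j < 2^(2M-i) = 2^M / 2^k says
   that this interval is contained in [0, 2^M]; see [dyadic_interval_inj] and
   [dyadic_intervalP]. *)
Definition dyadic (M : nat) : finType :=
  {i : 'I_(M.*2.+1) & 'I_(2 ^ (M.*2 - i))}.

Section Dyadic.
Variables (R : realType) (M : nat).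
Implicit Types I J : dyadic M.

Definition scale I : int := (tag I)%:Z - M%:Z.

Definition position I : nat := tagged I.

Definition len I : R := 2 ^ scale I.

Definition interval I : set R :=
  `[(position I)%:R * len I, (position I).+1%:R * len I]%classic.

Lemma len_gt0 I : 0 < len I.
Proof. exact: exprz_gt0. Qed.

Lemma itv_cc_sub (a b c d : R) : a <= b ->
  `[a, b]%classic `<=` `[c, d]%classic -> c <= a /\ b <= d.
Proof.
move=> ab sub; split.
  by have := sub a; rewrite /= !in_itv /= lexx ab => /(_ isT) /andP[].
by have := sub b; rewrite /= !in_itv /= lexx ab => /(_ isT) /andP[].
Qed.

Lemma interval_le I : (position I)%:R * len I <= (position I).+1%:R * len I.
Proof. by rewrite ler_pM2r ?len_gt0// ler_nat. Qed.

Lemma dyadic_interval_inj : injective interval.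
Proof.
move=> I J; rewrite /interval => eIJ.
have [lJ rJ] : (position J)%:R * len J <= (position I)%:R * len I /\
    (position I).+1%:R * len I <= (position J).+1%:R * len J.
  by apply: itv_cc_sub; [exact: interval_le | rewrite eIJ].
have [lI rI] : (position I)%:R * len I <= (position J)%:R * len J /\
    (position J).+1%:R * len J <= (position I).+1%:R * len I.
  by apply: itv_cc_sub; [exact: interval_le | rewrite eIJ].
have el : (position I)%:R * len I = (position J)%:R * len J.
  by apply/eqP; rewrite eq_le lI lJ.
have er : (position I).+1%:R * len I = (position J).+1%:R * len J.
  by apply/eqP; rewrite eq_le rI rJ.
have elen : len I = len J.
  move: er; rewrite -!natr1 !mulrDl !mul1r el; exact: addrI.
have epos : position I = position J.
  by move: el; rewrite elen => /(mulIf (lt0r_neq0 (len_gt0 J))) /eqP;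
    rewrite eqr_nat => /eqP.
have etag : tag I = tag J.
  have two_neq1 : (2 : R) != 1 by rewrite pnatr_eq1.
  by have /addIr[/val_inj] := ieexprIz (ltr0Sn R 1) two_neq1 elen.
clear -epos etag; case: I J epos etag => [i j] [i' j'].
rewrite /position /= => epos etag; subst i'.
by congr existT; exact: val_inj.
Qed.

Lemma dyadic_intervalP (A : set R) :
  (exists I, interval I = A) <->
  (exists j k : int, [/\ - M%:Z <= k, k <= M%:Z,
     A = `[j%:~R * 2 ^ k, (j + 1)%:~R * 2 ^ k]%classic &
     A `<=` `[0, 2 ^ M%:Z]%classic]).
Proof.
have pow2 (n : nat) : (2 : R) ^ n%:Z = (2 ^ n)%:R.
  by rewrite -exprnP natrX.
split=> [[I <-]|[j [k [kM Mk -> sub]]]].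
  exists (position I)%:Z, (scale I).
  have lt_i := ltn_ord (tag I).
  split; [by rewrite /scale; lia | by rewrite /scale; lia | |].
    by rewrite /interval -natr1 !pmulrn intrD.
  apply: subset_itvScc.
    by rewrite bnd_simp mulr_ge0 ?ler0n ?ltW ?len_gt0.
  have -> : (2 : R) ^ M%:Z = (2 ^ (M.*2 - tag I))%:R * len I.
    rewrite -pow2 /len -expfzDr ?pnatr_eq0//; congr (_ ^ _).
    by rewrite /scale; lia.
  by rewrite bnd_simp ler_pM2r ?len_gt0// ler_nat; exact: ltn_ord.
have k0 : (0 : R) < 2 ^ k by exact: exprz_gt0.
have [] := itv_cc_sub _ sub.
  by rewrite ler_pM2r// ler_int; lia.
rewrite pmulr_lge0// ler0z => j0.
have iP : (absz (k + M%:Z)%R < M.*2.+1)%N by lia.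
pose i := Ordinal iP.
have ei : i%:Z - M%:Z = k by rewrite /=; lia.
have -> : (2 : R) ^ M%:Z = (2 ^ (M.*2 - i))%:R * 2 ^ k.
  rewrite -pow2 -expfzDr ?pnatr_eq0//; congr (_ ^ _); move: ei; rewrite /=.
  by lia.
rewrite ler_pM2r// pmulrn ler_int => jM.
have jP : (absz j < 2 ^ (M.*2 - i))%N by move: jM; lia.
exists (Tagged (fun i : 'I_(M.*2.+1) => 'I_(2 ^ (M.*2 - i))) (Ordinal jP)).
rewrite /interval /len /scale /position [tag _]/= ei /=.
have -> : (`|j|%N%:R : R) = j%:~R by rewrite pmulrn gez0_abs.
have -> // : (`|j|%N.+1%:R : R) = (j + 1)%:~R.
by rewrite pmulrn -addn1 PoszD gez0_abs.
Qed.

(* The lacunary tile P^+(I).  As I |-> P^+(I) is injective, collections of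
   tiles are represented below by the sets of the underlying intervals. *)
Definition lacunary_tile I : set (R * R) :=
  interval I `*` `[(len I)^-1, 2 * (len I)^-1]%classic.

Lemma lacunary_tile_inj : injective lacunary_tile.
Proof.
have freq0 I : `[(len I)^-1, 2 * (len I)^-1]%classic (len I)^-1.
  have : 0 < (len I)^-1 by rewrite invr_gt0 len_gt0.
  by rewrite /= in_itv /= => l0; apply/andP; split; lra.
move=> I J eIJ; apply: dyadic_interval_inj; apply/seteqP; split=> x Ix.
  have : lacunary_tile J (x, (len I)^-1) by rewrite -eIJ; split.
  by case.
have : lacunary_tile I (x, (len J)^-1) by rewrite eIJ; split.
by case.
Qed.

Definition tile_le I J : Prop := interval I `<=` interval J.

Record tree := Tree {
  tiles :> {set dyadic M};
  top : dyadic M;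
  top_in : top \in tiles;
  le_top : forall I, I \in tiles -> tile_le I top }.

Definition convex_tiles (A : {set dyadic M}) : Prop :=
  forall I1 I I2 : dyadic M, I1 \in A -> I2 \in A ->
    tile_le I1 I -> tile_le I I2 -> I \in A.

Definition size_tree (a : dyadic M -> \bar R) (T : tree) : \bar R :=
  (((len (top T))^-1)%:E * \sum_(I in tiles T) a I)%E.

(* [ereal_sup] of the empty set is -oo, hence the case distinction. *)
Definition max_size (a : dyadic M -> \bar R) (A : {set dyadic M}) : \bar R :=
  if A == finset.set0 then 0%E else
  ereal_sup [set size_tree a T | T in
    [set T : tree | convex_tiles T /\ tiles T \subset A]].

End Dyadic.

Arguments len R {M} I.
Arguments interval R {M} I.

Definition half_plane (R : realType) : Type :=
  {z : measurableTypeR R * measurableTypeR R | (0 : R) < z.2}.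

HB.instance Definition _ (R : realType) := Choice.on (half_plane R).
HB.instance Definition _ (R : realType) :=
  isPointed.Build (half_plane R) (exist _ (0, 1) ltr01).

Definition half_plane_val (R : realType) :
  half_plane R -> measurableTypeR R * measurableTypeR R := sval.

Definition borel_half_plane (R : realType) :=
  g_sigma_algebra_preimageType (@half_plane_val R).

(* Closed, as in the definition of Q^+(I): neighbouring boxes overlap only in
   their boundaries, and measures that charge boundaries are not excluded. *)
Definition whitney_box (R : realType) (M : nat) (I : dyadic M) :
    set (borel_half_plane R) :=
  @half_plane_val R @^-1`
    (interval R I `*` `[len R I / 2, len R I]%classic).

Arguments whitney_box R {M} I.

(* Main.v *)
(** Writing a(I) for the mu'-mass of the Whitney box over I, only the weights a
    and mu matter.  Going from small to large intervals, call J heavy when the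
    mu-mass of the intervals I in J with no heavy interval L, I <= L < J (the
    stem of J), exceeds delta |J|.  The stem of a light interval is a convex
    tree of maximal size at most delta, so its a-mass is at most C2 |J|; the
    stem of any J consists of J and the stems of its light children, so its
    a-mass is at most (C1 + C2) |J|.  With K = (C1 + C2) / delta, heavy stems
    thus have a-mass at most K times their mu-mass, and heavy stems below J are
    disjoint, whence a(below J) <= a(stem J) + K (mu(below J) - mu(stem J)) by
    induction on J.  This gives C = 1 + A / delta, A the maximal size of mu. *)
Require Import Defs.
From mathcomp Require Import all_boot all_order all_algebra.
From mathcomp Require Import all_classical all_reals all_analysis.
From mathcomp Require Import lra zify.

Set Implicit Arguments.
Unset Strict Implicit.
Unset Printing Implicit Defensive.

Import Order.TTheory GRing.Theory Num.Theory.

Local Open Scope ring_scope.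

(** * Inclusion of dyadic intervals, children and sums over descendants *)

Section DyadicOrder.
Context {R : realType} {M : nat}.
Implicit Types I J L c : dyadic M.

Local Notation level I := (nat_of_ord (tag I)).

Lemma len_level I : len R I = (2 ^ level I)%:R * 2 ^ (- M%:Z).
Proof. by rewrite /len /scale expfzDr ?pnatr_eq0// -exprnP natrX. Qed.

(** In units of [2 ^ (- M)] all endpoints are natural numbers, so inclusion reduces to floor
    division: an ancestor is found by dropping low binary digits of the position. *)
Lemma tile_leP I J :
  tile_le R I J <->
  (level I <= level J)%N /\
  position J = (position I %/ 2 ^ (level J - level I))%N.
Proof.
have u0 : (0 : R) < 2 ^ (- M%:Z) by exact: exprz_gt0.
have itvP : tile_le R I J <->
    (position J * 2 ^ level J <= position I * 2 ^ level I)%N /\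
    ((position I).+1 * 2 ^ level I <= (position J).+1 * 2 ^ level J)%N.
  have endpoint p q i j : (p * 2 ^ i <= q * 2 ^ j)%N =
      (p%:R * ((2 ^ i)%:R * 2 ^ (- M%:Z)) <= q%:R * ((2 ^ j)%:R * 2 ^ (- M%:Z)) :> R).
    by rewrite !mulrA ler_pM2r// -!natrM ler_nat.
  rewrite !endpoint -!len_level.
  split=> [|[lo hi]]; first by apply: itv_cc_sub; exact: interval_le.
  by apply: subset_itvScc; rewrite bnd_simp.
have powJ : (level I <= level J)%N ->
    (2 ^ level J = 2 ^ (level J - level I) * 2 ^ level I)%N.
  by move=> leIJ; rewrite -expnD subnK.
rewrite itvP; split=> [[lo hi]|[leIJ ->]].
  have leIJ : (level I <= level J)%N.
    have : (2 ^ level I <= 2 ^ level J)%N.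
      by move: lo hi; rewrite !mulSn; lia.
    by rewrite leq_exp2l.
  split=> //; move: lo hi; rewrite powJ// !mulnA.
  rewrite !leq_pmul2r ?expn_gt0// => lo hi.
  by apply/esym/eqP; rewrite eqn_leq -ltnS ltn_divLR ?expn_gt0// hi leq_divRL ?expn_gt0.
rewrite powJ// !mulnA !leq_pmul2r ?expn_gt0//.
by rewrite leq_trunc_div ltn_ceil ?expn_gt0.
Qed.

Lemma level_inj I J : level I = level J -> position I = position J -> I = J.
Proof.
case: I J => [i p] [j q] /= /val_inj eij; subst j.
by rewrite /position /= => /val_inj ->.
Qed.

Definition below J : {set dyadic M} := [set I | `[< tile_le R I J >]]%SET.

Lemma belowP I J : reflect (tile_le R I J) (I \in below J).
Proof. by rewrite inE; exact: asboolP. Qed.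

Lemma below_refl J : J \in below J.
Proof. by apply/belowP. Qed.

Lemma below_trans I J L : I \in below J -> J \in below L -> I \in below L.
Proof. by move=> /belowP IJ /belowP JL; apply/belowP; exact: subset_trans JL. Qed.

Lemma below_level I J : I \in below J -> I != J -> (level I < level J)%N.
Proof.
move=> /belowP/tile_leP[leIJ pJ]; rewrite ltn_neqAle leIJ andbT.
apply: contra => /eqP e; apply/eqP/level_inj => //.
by rewrite pJ e subnn divn1.
Qed.

Definition children J : {set dyadic M} :=
  [set c in below J | (level c).+1 == level J]%SET.

Lemma children_below c J : c \in children J -> c \in below J.
Proof. by rewrite inE => /andP[]. Qed.

Lemma children_level c J : c \in children J -> (level c).+1 = level J.
Proof. by rewrite inE => /andP[_ /eqP]. Qed.

Lemma children_neq c J : c \in children J -> c != J.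
Proof.
by move=> /children_level; apply: contra_eqN => /eqP ->; rewrite -[_ == _]negbK neq_ltn ltnSn orbT.
Qed.

(** The child is the ancestor of [I] one level under [J], so its position is a quotient of that of
    [I]; iterated division shows that it lies below [J]. *)
Lemma child_above I J : I \in below J -> I != J ->
  exists2 c, c \in children J & I \in below c.
Proof.
move=> IJ neIJ; have ltIJ := below_level IJ neIJ.
have /belowP/tile_leP[leIJ pJ] := IJ.
have [c lc pc] : exists2 c : dyadic M, level c = (level J).-1 &
    position c = (position I %/ 2 ^ ((level J).-1 - level I))%N.
  have kP : ((level J).-1 < M.*2.+1)%N by have := ltn_ord (tag J); lia.
  have pP : (position I %/ 2 ^ ((level J).-1 - level I)
             < 2 ^ (M.*2 - Ordinal kP))%N.
    rewrite ltn_divLR ?expn_gt0// -expnD.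
    have -> : (M.*2 - Ordinal kP + ((level J).-1 - level I) =
               M.*2 - level I)%N.
      move: ltIJ (ltn_ord (tag J)); rewrite [nat_of_ord (Ordinal kP)]/=.
      by move: (level J) (level I) => j i; clear; lia.
    exact: ltn_ord.
  by exists (Tagged (fun i : 'I_(M.*2.+1) => 'I_(2 ^ (M.*2 - i))) (Ordinal pP)).
have Ic : I \in below c.
  by apply/belowP/tile_leP; rewrite lc pc; split=> //; lia.
exists c => //; rewrite inE; apply/andP; split; last by apply/eqP; lia.
apply/belowP/tile_leP; split; first by lia.
rewrite pc pJ -divnMA -expnD; congr (_ %/ 2 ^ _)%N; lia.
Qed.

Lemma child_above_uniq I J c c' : c \in children J -> c' \in children J ->
  I \in below c -> I \in below c' -> c = c'.
Proof.
move=> /children_level cJ /children_level c'J.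
move=> /belowP/tile_leP[_ pc] /belowP/tile_leP[_ pc'].
by apply: level_inj; [lia | rewrite pc pc'; congr (_ %/ 2 ^ _)%N; lia].
Qed.

(** Children have half the length of [J], and the parity of the position tells them apart, so there
    are at most two. At the finest level there are none, hence an inequality. *)
Lemma sum_len_children J : \sum_(c in children J) len R c <= len R J.
Proof.
have len_child c : c \in children J -> len R c = len R J / 2.
  by move=> /children_level cJ; rewrite !len_level -cJ expnS natrM -mulrA [RHS]mulrC mulKf ?pnatr_eq0.
rewrite (eq_bigr _ len_child) sumr_const -[_ *+ #|_|]mulr_natr.
have le2 : (#|children J| <= 2)%N.
  rewrite -card_bool -(@card_in_imset _ _ (fun c => odd (position c))) ?max_card//.
  move=> c c' cJ c'J /= eodd; apply: level_inj.
    by have := children_level cJ; have := children_level c'J; lia.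
  have half d : d \in children J -> position J = (position d)./2.
    move=> dJ; have /belowP/tile_leP[_ ->] := children_below dJ.
    by rewrite -(children_level dJ) subSnn expn1 divn2.
  by rewrite -(odd_double_half (position c)) -(odd_double_half (position c'))
    eodd -!half.
apply: (@le_trans _ _ (len R J / 2 * 2)); last by rewrite divfK ?pnatr_eq0.
by rewrite ler_pM2l ?divr_gt0 ?len_gt0// ler_nat.
Qed.

Lemma below_antisym I J : I \in below J -> J \in below I -> I = J.
Proof.
by move=> /belowP IJ /belowP JI; apply/(@dyadic_interval_inj R)/seteqP; split.
Qed.

(** Each interval strictly below [J] lies below exactly one child of [J]. *)
Lemma sum_below (f : dyadic M -> R) (J : dyadic M) :
  \sum_(I in below J) f I =
  f J + \sum_(c in children J) \sum_(I in below c) f I.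
Proof.
rewrite (bigD1 J) ?below_refl//=; congr (_ + _).
rewrite (exchange_big_dep (fun I => (I \in below J) && (I != J)))/=; last first.
  move=> c I cJ Ic; rewrite (below_trans Ic (children_below cJ))/=.
  apply: contraNneq (children_neq cJ) => e; subst I.
  by apply/eqP; apply: below_antisym Ic; exact: children_below.
apply: eq_bigr => I /andP[IJ neIJ]; have [c cJ Ic] := child_above IJ neIJ.
rewrite (big_pred1 c)// => c'; apply/andP/eqP => [[c'J Ic']|->//].
exact: child_above_uniq c'J cJ Ic' Ic.
Qed.

(** * Stems and the heavy set *)

Definition stem (S : {set dyadic M}) J : {set dyadic M} :=
  [set I in below J |
    [forall L in S, (I \in below L) && (L \in below J) ==> (L == J)]]%SET.

Lemma stemP (S : {set dyadic M}) I J : reflect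
  (I \in below J /\
   forall L, L \in S -> I \in below L -> L \in below J -> L = J)
  (I \in stem S J).
Proof.
rewrite [X in reflect _ X]inE; apply: (iffP andP) => -[IJ sIJ]; split=> //.
  move=> L LS IL LJ; have := forallP sIJ L.
  by rewrite LS IL LJ => /eqP.
apply/forall_inP => L LS; apply/implyP => /andP[IL LJ].
by apply/eqP/sIJ.
Qed.

Lemma stem_below (S : {set dyadic M}) I J : I \in stem S J -> I \in below J.
Proof. by case/stemP. Qed.

(** Exempting [L = J] in [stem] keeps [J] in its own stem even when [J] is in [S]. *)
Lemma stem_refl (S : {set dyadic M}) J : J \in stem S J.
Proof.
apply/stemP; split=> [|L _ JL LJ]; [exact: below_refl | exact: below_antisym].
Qed.

(** Any [L] other than [J] between [I] and [J] lies below a child, which must be [c]; so the only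
    obstruction not seen by the stem of [c] is [c] itself. *)
Lemma stem_child (S : {set dyadic M}) I J c :
  c \in children J -> I \in below c ->
  (I \in stem S J) = (c \notin S) && (I \in stem S c).
Proof.
move=> cJ Ic; have cbJ := children_below cJ.
apply/stemP/andP => [[IJ sIJ]|[cS /stemP[_ sIc]]].
  split.
    apply/negP => cS; have /eqP := children_neq cJ; apply.
    exact: sIJ.
  apply/stemP; split=> // L LS IL Lc.
  have LJ := sIJ L LS IL (below_trans Lc cbJ); subst L.
  exact: below_antisym.
split=> [|L LS IL LJ]; first exact: below_trans cbJ.
apply/eqP/negPn/negP => /(child_above LJ)[c' c'J Lc'].
have cc' := child_above_uniq cJ c'J Ic (below_trans IL Lc'); subst c'.
by move: cS; rewrite -(sIc L LS IL Lc') LS.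
Qed.

Lemma sum_stem (S : {set dyadic M}) (f : dyadic M -> R) J :
  \sum_(I in stem S J) f I =
  f J + \sum_(c in children J | c \notin S) \sum_(I in stem S c) f I.
Proof.
pose g I := if I \in stem S J then f I else 0.
have -> : \sum_(I in stem S J) f I = \sum_(I in below J) g I.
  rewrite -big_mkcondr; apply: eq_bigl => I.
  by apply/idP/andP => [IJ|[]//]; split=> //; exact: stem_below IJ.
rewrite sum_below {1}/g stem_refl; congr (_ + _).
rewrite big_mkcondr; apply: eq_bigr => c cJ; case: ifPn => cS.
  rewrite -[LHS]big_mkcondr; apply: eq_bigl => I.
  apply/andP/idP => [[Ic]|Isc]; first by rewrite (stem_child _ cJ Ic) cS.
  by have Ic := stem_below Isc; rewrite (stem_child _ cJ Ic) cS.
apply: big1 => I Ic.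
by rewrite /g (stem_child _ cJ Ic) (negbTE cS).
Qed.

(* Whether J is heavy only depends on the heavy intervals strictly below J, so
   iterating the defining condition stabilises one level at a time. *)
Lemma heavy_set_exists (mu : dyadic M -> R) (delta : R) :
  exists S : {set dyadic M}, forall J,
    (J \in S) = (delta * len R J < \sum_(I in stem S J) mu I).
Proof.
pose step (S : {set dyadic M}) : {set dyadic M} :=
  [set J | delta * len R J < \sum_(I in stem S J) mu I]%SET.
pose S n := iter n step (finset.set0 : {set dyadic M}).
have stable n J : (level J < n)%N -> (J \in S n) = (J \in S n.+1).
  elim: n J => // n IHn J ltJn; rewrite [LHS]inE [RHS]inE -/(S n.+1) -/(S n).
  congr (_ < _); apply: eq_bigl => I.
  have agree L : L \in below J -> L != J -> (L \in S n) = (L \in S n.+1).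
    by move=> LJ /(below_level LJ) ltLJ; apply: IHn; exact: (leq_trans ltLJ).
  apply/stemP/stemP => -[IJ sIJ]; split=> // L LS IL LJ;
    apply/eqP/negPn/negP => neLJ; move/eqP: (neLJ); apply; apply: sIJ => //.
    by rewrite agree.
  by rewrite -agree.
(* Levels are at most [2M], so [2M + 1] iterations settle every interval. *)
by exists (S M.*2.+1) => J; rewrite stable ?ltn_ord// inE.
Qed.

(** Smallness of a tree is tested on its whole [mu]-mass below each member [J]. As [mu] is
    non-negative, this dominates every subtree with top [J] and avoids the supremum in the maximal
    size. *)
Lemma carleson_of_light_trees (mu a : dyadic M -> R) (delta C1 C2 : R) :
  0 < delta -> 0 <= C1 -> 0 <= C2 ->
  (forall I, 0 <= mu I) ->
  (forall I, a I <= C1 * len R I) ->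
  (forall T : tree R M, convex_tiles R T ->
    (forall J, J \in tiles T ->
       \sum_(I in tiles T | I \in below J) mu I <= delta * len R J) ->
    \sum_(I in tiles T) a I <= C2 * len R (top T)) ->
  forall J, \sum_(I in below J) a I <=
    (C1 + C2) * len R J + (C1 + C2) / delta * \sum_(I in below J) mu I.
Proof.
move=> delta0 C10 C20 mu0 aC1 light.
have [S heavyP] := heavy_set_exists mu delta.
set K := (C1 + C2) / delta.
have K0 : 0 <= K by rewrite divr_ge0 ?addr_ge0// ltW.
have stem_light J : J \notin S -> \sum_(I in stem S J) a I <= C2 * len R J.
  move=> JS.
  pose T := @Tree R M (stem S J) J (stem_refl S J)
    (fun I sI => elimT (belowP I J) (stem_below sI)).
  have notS I L : I \in stem S J -> I \in below L -> L \in below J -> L \notin S.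
    move=> /stemP[_ sIJ] IL LJ; apply/negP => LS.
    by move: JS; rewrite -(sIJ L LS IL LJ) LS.
  apply: (light T) => [I1 I I2 /= sI1 sI2 /belowP I1I /belowP II2|L /= LJ].
    have IJ := below_trans II2 (stem_below sI2).
    apply/stemP; split=> // L LS IL LJ; exfalso.
    by have := notS _ _ sI1 (below_trans I1I IL) LJ; rewrite LS.
  have : L \notin S := notS _ _ LJ (below_refl L) (stem_below LJ).
  (* [L] is light, and the part of the stem of [J] below [L] lies in the stem of [L]. *)
  rewrite heavyP -leNgt; apply: le_trans.
  rewrite [leRHS]big_mkcond [leLHS]big_mkcond/=; apply: ler_sum => I _.
  case: ifPn => [/andP[sIJ IL]|_]; last by case: ifP.
  rewrite ifT//; apply/stemP; split=> // L' L'S IL' L'L; exfalso.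
  have := notS _ _ sIJ IL' (below_trans L'L (stem_below LJ)).
  by rewrite L'S.
have stem_le J : \sum_(I in stem S J) a I <= (C1 + C2) * len R J.
  rewrite sum_stem mulrDl lerD//.
  apply: (@le_trans _ _ (C2 * \sum_(c in children J) len R c)).
    rewrite mulr_sumr big_mkcondr; apply: ler_sum => c _.
    by case: ifPn => [/stem_light//|_]; rewrite mulr_ge0// ltW// len_gt0.
  by rewrite ler_wpM2l// sum_len_children.
have main J : \sum_(I in below J) a I <= \sum_(I in stem S J) a I +
    K * (\sum_(I in below J) mu I - \sum_(I in stem S J) mu I).
  have [n] := ubnP (level J); elim: n J => // n IHn J ltJn.
  (* For a heavy child the stem terms vanish: its stem is not part of the stem of [J], and its
     [a]-mass is absorbed into [K] times its [mu]-mass. *)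
  have IHc c : c \in children J -> \sum_(I in below c) a I <=
      (if c \notin S then \sum_(I in stem S c) a I else 0) +
      K * (\sum_(I in below c) mu I -
        (if c \notin S then \sum_(I in stem S c) mu I else 0)).
    move=> cJ; apply: le_trans (IHn c _) _.
      by have := children_level cJ; lia.
    case: ifPn => //; rewrite negbK => cS.
    suff : \sum_(I in stem S c) a I <= K * \sum_(I in stem S c) mu I by lra.
    apply: le_trans (stem_le c) _; move: cS; rewrite heavyP => /ltW muc.
    rewrite /K mulrAC -mulrA ler_wpM2l ?addr_ge0// ler_pdivlMr//.
    by rewrite mulrC.
  (* Summed over the children, the stems of the light ones recombine with [J] into the stem of
     [J]. *)
  have /= := ler_sum (index_enum _) IHc.
  rewrite big_split/= -mulr_sumr sumrB -!big_mkcondr => sum_le.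
  by rewrite !sum_below !sum_stem; lra.
move=> J; apply: le_trans (main J) _; apply: lerD (stem_le J) _.
by rewrite ler_wpM2l// lerBlDr lerDl sumr_ge0.
Qed.

End DyadicOrder.

(** * Extended-real sizes versus real sums *)

Section Sizes.
Context {R : realType} {M : nat}.
Local Open Scope ereal_scope.

Lemma size_treeE (f : dyadic M -> R) (T : tree R M) :
  size_tree (fun I => (f I)%:E) T =
  ((len R (top T))^-1 * \sum_(I in tiles T) f I)%:E.
Proof. by rewrite /size_tree sumEFin. Qed.

Lemma max_size_le (a : dyadic M -> \bar R) (A : {set dyadic M}) (b : R) :
  (0 <= b)%R ->
  (forall T : tree R M, convex_tiles R T -> tiles T \subset A ->
    size_tree a T <= b%:E) ->
  max_size a A <= b%:E.
Proof.
move=> b0 ab; rewrite /max_size; case: ifP => _; first by rewrite lee_fin.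
by apply: ge_ereal_sup => _ [T [convT TA] <-]; exact: ab.
Qed.

Lemma size_tree_le_max (a : dyadic M -> \bar R) (A : {set dyadic M})
    (T : tree R M) :
  convex_tiles R T -> tiles T \subset A -> size_tree a T <= max_size a A.
Proof.
move=> convT TA; rewrite /max_size; case: ifPn => [/eqP A0|_].
  by have := fintype.subsetP TA _ (top_in T); rewrite A0 inE.
by apply: ereal_sup_ubound; exists T.
Qed.

Lemma sum_below_le_max_size (f : dyadic M -> R) (J : dyadic M) :
  (forall I, 0 <= f I)%R ->
  max_size (R := R) (fun I => (f I)%:E) [set: dyadic M]%SET < +oo ->
  (\sum_(I in below J (R := R)) f I <=
   fine (max_size (R := R) (fun I => (f I)%:E) [set: dyadic M]%SET) * len R J)%R.
Proof.
move=> f0 fin.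
pose T := @Tree R M (below J) J (below_refl J) (fun I => elimT (belowP I J)).
have convT : convex_tiles R T.
  by move=> I1 I I2 _ /= I2J _ /belowP II2; exact: below_trans I2J.
have := size_tree_le_max (fun I => (f I)%:E) convT (finset.subsetT _).
rewrite size_treeE /= => le_max.
(* The size of [T], a real number, bounds the supremum from below and excludes [-oo]. *)
have finA : max_size (R := R) (fun I => (f I)%:E) [set: dyadic M]%SET
    \is a fin_num.
  by rewrite fin_real// fin andbT (lt_le_trans _ le_max)// ltNyr.
by move: le_max; rewrite -{1}(fineK finA) lee_fin mulrC ler_pdivrMr// len_gt0.
Qed.

End Sizes.

Local Open Scope ereal_scope.

Theorem corollary3p9 (R : realType) :
  exists C : \bar R -> R -> R,
  forall (M : nat) (M_gt0 : (0 < M)%N)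
    (mu : dyadic M -> R) (mu_ge0 : forall I, (0 <= mu I)%R)
    (mu_bounded : max_size (fun I => (mu I)%:E) [set: dyadic M]%SET < +oo)
    (delta : R) (delta_gt0 : (0 < delta)%R)
    (mu' : {measure set (borel_half_plane R) -> \bar R})
    (C1 C2 : R) (C1_ge0 : (0 <= C1)%R) (C2_ge0 : (0 <= C2)%R)
    (weak_carleson :
       forall I : dyadic M, mu' (whitney_box R I) <= (C1 * len R I)%:E)
    (small_size : forall T : tree R M, convex_tiles R T ->
       max_size (fun I => (mu I)%:E) T <= delta%:E ->
       size_tree (fun I => mu' (whitney_box R I)) T <= C2%:E),
  max_size (fun I => mu' (whitney_box R I)) [set: dyadic M]%SET
    <= (C (max_size (fun I => (mu I)%:E) [set: dyadic M]%SET) delta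
         * (C1 + C2))%:E.
Proof.
(* The absolute value makes the constant non-negative at once; [fine] loses nothing, since the
   maximal size is finite here. *)
exists (fun A delta => 1 + `|fine A| / delta)%R => M M_gt0 mu mu_ge0 mu_bounded
  delta delta_gt0 mu' C1 C2 C1_ge0 C2_ge0 weak_carleson small_size.
set A := max_size _ _ in mu_bounded *.
pose a (I : dyadic M) := fine (mu' (whitney_box R I)).
have aE : (fun I : dyadic M => mu' (whitney_box R I)) = (fun I => (a I)%:E).
  apply/funext => I; rewrite fineK// ge0_fin_numE//.
  exact: le_lt_trans (weak_carleson I) (ltry _).
have a_ge0 I : (0 <= a I)%R by exact: fine_ge0.
have boxE (I : dyadic M) : mu' (whitney_box R I) = (a I)%:E by exact: (congr1 (@^~ I) aE).
have size_le (f : dyadic M -> R) (T : tree R M) (b : R) :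
    (size_tree (fun I => (f I)%:E) T <= b%:E) =
    (\sum_(I in tiles T) f I <= b * len R (top T))%R.
  by rewrite size_treeE lee_fin mulrC ler_pdivrMr// len_gt0.
rewrite aE; apply: max_size_le => [|T convT _].
  by rewrite mulr_ge0 ?addr_ge0 ?divr_ge0 ?normr_ge0// ltW.
(* Enlarging the tree to everything below its top only increases the mass. *)
rewrite size_le; apply: (@le_trans _ _ (\sum_(I in below (top T) (R := R)) a I)%R).
  rewrite [leRHS]big_mkcond [leLHS]big_mkcond/=; apply: ler_sum => I _.
  case: ifPn => [IT|_]; last by case: ifP.
  by rewrite ifT//; apply/belowP; exact: le_top.
apply: le_trans (carleson_of_light_trees delta_gt0 C1_ge0 C2_ge0 mu_ge0 _ _ _) _.
- by move=> I; rewrite -lee_fin -boxE.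
- move=> U convU lightU; rewrite -size_le -aE; apply: small_size => //.
  (* A subtree [V] of [U] has its top in [U] and lies in the part of [U] below that top, where
     [lightU] applies. *)
  apply: max_size_le => [|V convV VU]; first exact: ltW.
  rewrite size_le; apply: le_trans (lightU _ (fintype.subsetP VU _ (top_in V))).
  rewrite [leRHS]big_mkcond [leLHS]big_mkcond/=; apply: ler_sum => I _.
  case: ifPn => [IV|_]; last by case: ifP.
  by rewrite (fintype.subsetP VU _ IV) ifT//; apply/belowP; exact: le_top.
have muJ : (\sum_(I in below (top T) (R := R)) mu I <= `|fine A| * len R (top T))%R.
  apply: le_trans (sum_below_le_max_size _ mu_ge0 mu_bounded) _.
  by rewrite ler_wpM2r ?ler_norm// ltW// len_gt0.
have K0 : (0 <= (C1 + C2) / delta)%R by rewrite divr_ge0 ?addr_ge0// ltW.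
have := ler_wpM2l K0 muJ; lra.
Qed.
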